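(* Let $n\ge 1$ and $k\ge 0$ be integers, let $l\in\{0,1\}$, and let $f:(\mathbb{R}^n)^{\otimes k}\to(\mathbb{R}^n)^{\otimes l}$ be a linear permutation equivariant function on symmetric tensors (scalar-valued if $l=0$, vector-valued if $l=1$), i.e. $f$ is linear, satisfies $$f(e_{\sigma(i_1)}\otimes\cdots\otimes e_{\sigma(i_k)})=\sigma\cdot f(e_{i_1}\otimes\cdots\otimes e_{i_k})\quad\text{for all }\sigma\in S_n,\ (i_1,\dots,i_k)\in[n]^k,$$ and satisfies $$f(e_{i_1}\otimes\cdots\otimes e_{i_k})=f(e_{i_{\pi(1)}}\otimes\cdots\otimes e_{i_{\pi(k)}})\quad\text{for all }\pi\in S_k,\ (i_1,\dots,i_k)\in[n]^k.$$ Then $f$ is an element of $\operatorname{Hom}_{S_n}(S^k(\mathbb{R}^n),S^l(\mathbb{R}^n))$, in the following sense: the linear map $\bar f:S^k(\mathbb{R}^n)\to S^l(\mathbb{R}^n)$ given on the standard basis by $\bar f(e_J)=f(e_{j_1}\otimes\cdots\otimes e_{j_k})$ for $J=(j_1,\dots,j_k)\in S[n]^k$ lies in $\operatorname{Hom}_{S_n}(S^k(\mathbb{R}^n),S^l(\mathbb{R}^n))$, and $f(e_{i_1}\otimes\cdots\otimes e_{i_k})=\bar f(e_{\operatorname{sort}(i_1,\dots,i_k)})$ for all $(i_1,\dots,i_k)\in[n]^k$.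
   Context: $[n]=\{1,\dots,n\}$; $e_1,\dots,e_n$ is the standard basis of $\mathbb{R}^n$. $S[n]^k$ is the set of weakly increasing $k$-tuples with entries in $[n]$ (for $k=0$, only the empty tuple). For a tuple $I$, $\operatorname{sort}(I)$ is the tuple with the same entries rearranged in weakly increasing order. $S^k(\mathbb{R}^n)$ is the real vector space with standard basis $\{e_I\}$ indexed by $I\in S[n]^k$. The group $S_n$ acts on $S[n]^k$ by $\sigma\cdot(i_1,\dots,i_k)=\operatorname{sort}(\sigma(i_1),\dots,\sigma(i_k))$, and $\rho_k^S$ is the resulting representation on $S^k(\mathbb{R}^n)$, $\rho^S_k(\sigma)e_I=e_{\sigma\cdot I}$. $\operatorname{Hom}_{S_n}(S^k(\mathbb{R}^n),S^l(\mathbb{R}^n))$ is the vector space of linear maps $g$ with $g(\rho_k^S(\sigma)v)=\rho_l^S(\sigma)g(v)$ for all $\sigma\in S_n$, $v\in S^k(\mathbb{R}^n)$. The space $(\mathbb{R}^n)^{\otimes 0}=\mathbb{R}$ carries the trivial $S_n$-action and is identified with $S^0(\mathbb{R}^n)$; $(\mathbb{R}^n)^{\otimes 1}=\mathbb{R}^n$ carries the action $\sigma\cdot e_i=e_{\sigma(i)}$ and is identified with $S^1(\mathbb{R}^n)$. *)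

(* Defs.v *)
From HB Require Import structures.
From mathcomp Require Import all_boot all_order all_algebra all_fingroup.
From mathcomp Require Import reals.

Set Implicit Arguments.
Unset Strict Implicit.
Unset Printing Implicit Defensive.

Import Order.TTheory GRing.Theory.
Local Open Scope ring_scope.

Section LinearExtension.
Variables (R : fieldType) (I : finType) (V : vectType R).

Definition lin_ext_fun (F : I -> V) (v : {ffun I -> R^o}) : V :=
  \sum_i v i *: F i.

Fact lin_ext_fun_is_linear F : linear (lin_ext_fun F).
Proof.
move=> a u v; rewrite /lin_ext_fun scaler_sumr -big_split /=.
by apply: eq_bigr => i _; rewrite !ffunE scalerDl -scalerA.
Qed.

HB.instance Definition _ F := GRing.isLinear.Build R {ffun I -> R^o} V _
  (lin_ext_fun F) (lin_ext_fun_is_linear F).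

(* The linear map sending the standard basis vector of index i to F i. *)
Definition lin_ext (F : I -> V) : 'Hom({ffun I -> R^o}, V) :=
  linfun (lin_ext_fun F).

Definition std_basis (i : I) : {ffun I -> R^o} := [ffun j => (j == i)%:R].

Lemma lin_ext_basis F i : lin_ext F (std_basis i) = F i.
Proof.
rewrite lfunE /= /lin_ext_fun (bigD1 i) //= ffunE eqxx scale1r big1 ?addr0 //.
by move=> j /negPf ji; rewrite ffunE ji scale0r.
Qed.
End LinearExtension.

(* S[n]^k *)
Notation stuple n k := {I : k.-tuple 'I_n | sorted <=%O I}.

Section Tuples.
Variables n k : nat.

Definition perm_tuple (s : 'S_n) (I : k.-tuple 'I_n) : k.-tuple 'I_n :=
  [tuple of map s I].

Fact sort_tuple_sorted (I : k.-tuple 'I_n) :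
  sorted <=%O [tuple of sort <=%O I].
Proof. by apply: sort_sorted; apply: le_total. Qed.

Definition sort_stuple (I : k.-tuple 'I_n) : stuple n k :=
  exist _ [tuple of sort <=%O I] (sort_tuple_sorted I).

Definition act_stuple (s : 'S_n) (J : stuple n k) : stuple n k :=
  sort_stuple (perm_tuple s (val J)).
End Tuples.

(* The tensor power (R^n)^{(x) k}, as k-dimensional arrays of size n. For k = 0
   there is a single (empty) multi-index, and for k = 1 an index is an element
   of 'I_n, so these are R and R^n. *)
Notation tpow R n k := {ffun k.-tuple 'I_n -> R^o}.
(* S^k(R^n) *)
Notation spow R n k := {ffun stuple n k -> R^o}.


Section Spaces.
Variables (R : realType) (n : nat).

(* v_1 (x) ... (x) v_k *)
Definition tensor k (v : k.-tuple 'rV[R]_n) : tpow R n k :=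
  [ffun I : k.-tuple 'I_n => \prod_(j < k) tnth v j 0 (tnth I j) : R^o].

(* e_{i_1} (x) ... (x) e_{i_k} *)
Definition etensor k (I : k.-tuple 'I_n) : tpow R n k :=
  tensor [tuple of map (fun i : 'I_n => delta_mx 0 i) I].

Lemma etensorE k (I : k.-tuple 'I_n) : etensor I = std_basis R I.
Proof.
apply/ffunP => J; rewrite !ffunE.
have [-> | neJI] := eqVneq J I.
  by apply: big1 => j _; rewrite tnth_map mxE !eqxx.
have /existsP[j nej] : [exists j, tnth J j != tnth I j].
  rewrite -negb_forall; apply: contra neJI => /forallP eqJI.
  by apply/eqP/eq_from_tnth => j; apply/eqP.
by rewrite (bigD1 j) //= tnth_map mxE (negPf nej) andbF mul0r.
Qed.

(* s . (e_{i_1} (x) ... (x) e_{i_k}) = e_{s(i_1)} (x) ... (x) e_{s(i_k)};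
   this is the trivial action for k = 0 and s . e_i = e_{s(i)} for k = 1. *)
Definition tpow_rep k (s : 'S_n) : 'Hom(tpow R n k, tpow R n k) :=
  lin_ext (fun I : k.-tuple 'I_n => etensor (perm_tuple s I)).

Definition ebasis k (J : stuple n k) : spow R n k := std_basis R J.

Definition spow_rep k (s : 'S_n) : 'Hom(spow R n k, spow R n k) :=
  lin_ext (fun J : stuple n k => ebasis (act_stuple s J)).

Section Equivariant.
Variables k l : nat.

Definition equiv_defect (s : 'S_n) (g : 'Hom(spow R n k, spow R n l)) :
  'Hom(spow R n k, spow R n l) := ((g \o spow_rep k s) - (spow_rep l s \o g))%VF.

Fact equiv_defect_is_linear s : linear (equiv_defect s).
Proof.
move=> a g h; rewrite /equiv_defect comp_lfunDl comp_lfunDr.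
by rewrite -comp_lfunZl -comp_lfunZr scalerBr opprD addrACA.
Qed.

HB.instance Definition _ s := GRing.isLinear.Build R 'Hom(spow R n k, spow R n l)
  'Hom(spow R n k, spow R n l) _ (equiv_defect s) (equiv_defect_is_linear s).

(* Hom_{S_n}(S^k(R^n), S^l(R^n)); see HomSnP. *)
Definition HomSn : {vspace 'Hom(spow R n k, spow R n l)} :=
  (\bigcap_(s : 'S_n) lker (linfun (equiv_defect s)))%VS.

Lemma HomSnP (g : 'Hom(spow R n k, spow R n l)) :
  reflect (forall (s : 'S_n) (v : spow R n k),
             g (spow_rep k s v) = spow_rep l s (g v))
          (g \in HomSn).
Proof.
rewrite memvE; apply: (iffP subv_bigcapP) => [gE s v | gE s _].
  have := gE s isT; rewrite -memvE memv_ker lfunE /= subr_eq0 => /eqP/lfunP/(_ v).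
  by rewrite !comp_lfunE.
rewrite -memvE memv_ker lfunE /= subr_eq0; apply/eqP/lfunP => v.
by rewrite !comp_lfunE.
Qed.
End Equivariant.

(* Restriction of an array to weakly increasing indices. Only meant for l <= 1,
   where every l-tuple is weakly increasing and this is the identification of
   (R^n)^{(x) l} with S^l(R^n): see
   tpow_to_spow_bij, tpow_to_spow_basis and tpow_to_spow_equiv. *)
Definition tpow_to_spow_fun l (t : tpow R n l) : spow R n l :=
  [ffun J : stuple n l => t (val J)].

Fact tpow_to_spow_fun_is_linear l : linear (@tpow_to_spow_fun l).
Proof. by move=> a t u; apply/ffunP => J; rewrite !ffunE. Qed.

HB.instance Definition _ l := GRing.isLinear.Build R (tpow R n l) (spow R n l) _
  (@tpow_to_spow_fun l) (@tpow_to_spow_fun_is_linear l).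

Definition tpow_to_spow l : 'Hom(tpow R n l, spow R n l) := linfun (@tpow_to_spow_fun l).

Lemma sorted_le1 l (I : l.-tuple 'I_n) : (l <= 1)%N -> sorted <=%O I.
Proof. by case: I => [[|a [|b s]] /= /eqP <-]. Qed.

Lemma tpow_to_spow_bij l : (l <= 1)%N -> bijective (tpow_to_spow l).
Proof.
move=> l1; exists (fun u : spow R n l =>
  [ffun I : l.-tuple 'I_n => u (exist _ I (sorted_le1 I l1))] : tpow R n l) => t.
  by apply/ffunP => I; rewrite ffunE lfunE /= ffunE.
apply/ffunP => -[J sJ]; rewrite lfunE /= !ffunE /=.
by rewrite (bool_irrelevance (sorted_le1 J l1) sJ).
Qed.

Lemma sort_stuple_le1 l (I : l.-tuple 'I_n) :
  (l <= 1)%N -> val (sort_stuple I) = I.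
Proof.
move=> l1; apply: val_inj => /=.
by rewrite sorted_sort //; [apply: le_trans | apply: sorted_le1].
Qed.

Lemma tpow_to_spow_basis l (I : l.-tuple 'I_n) :
  (l <= 1)%N -> tpow_to_spow l (etensor I) = ebasis (sort_stuple I).
Proof.
move=> l1; apply/ffunP => J; rewrite lfunE /= etensorE !ffunE.
by rewrite -[J == _]val_eqE sort_stuple_le1.
Qed.

Lemma tpow_to_spow_equiv l (s : 'S_n) (t : tpow R n l) : (l <= 1)%N ->
  tpow_to_spow l (tpow_rep l s t) = spow_rep l s (tpow_to_spow l t).
Proof.
move=> l1.
have -> : t = \sum_I t I *: etensor I.
  apply/ffunP => I; rewrite sum_ffunE (bigD1 I) //= etensorE !ffunE eqxx [_ *: _]mulr1.
  rewrite big1 ?addr0 // => J neJI.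
  by rewrite etensorE !ffunE eq_sym (negPf neJI) scaler0.
rewrite !linear_sum /=; apply: eq_bigr => I _; rewrite !linearZ /=; congr (_ *: _).
rewrite tpow_to_spow_basis // [in LHS]etensorE !lin_ext_basis.
rewrite tpow_to_spow_basis //; congr (ebasis (sort_stuple _)).
by rewrite sort_stuple_le1.
Qed.
End Spaces.

(* Main.v *)
Require Import Defs.
From mathcomp Require Import all_boot all_order all_algebra all_fingroup.
From mathcomp Require Import reals.
Local Open Scope ring_scope.

Import GRing.Theory.

(** Symmetry makes [f] blind to the order of a multi-index, so its value on basis tensors factors
    through sorting ([sym_sort]); this is the formula relating [f] and [fbar]. Equivariance of
    [fbar] need only be tested on basis vectors ([lfun_eq_basis]). There the action permutes the
    values and then sorts, and since [f] does not see the sorting, equivariance of [f] itself is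
    enough. *)

Lemma std_basis_sum (R : fieldType) (I : finType) (v : {ffun I -> R^o}) :
  v = \sum_i v i *: std_basis R i.
Proof.
apply/ffunP => i; rewrite sum_ffunE (bigD1 i) //= !ffunE eqxx [_ *: _]mulr1.
by rewrite big1 ?addr0 // => j neji; rewrite !ffunE eq_sym (negPf neji) scaler0.
Qed.

Lemma lfun_eq_basis (R : fieldType) (I : finType) (V : vectType R)
    (g h : 'Hom({ffun I -> R^o}, V)) :
  (forall i, g (std_basis R i) = h (std_basis R i)) -> g = h.
Proof.
move=> eq_gh; apply/lfunP => v; rewrite (std_basis_sum _ _ v) !linear_sum.
by apply: eq_bigr => i _; rewrite !linearZ /= eq_gh.
Qed.

(** Sorting a tuple only permutes its positions, and [tuple_permP] supplies that permutation as an
    element of ['S_k], to which the symmetry of [F] applies. *)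
Lemma sym_sort (T : Type) (n k : nat) (F : k.-tuple 'I_n -> T) :
  (forall (p : 'S_k) I, F I = F [tuple tnth I (p j) | j < k]) ->
  forall I, F I = F (val (sort_stuple I)).
Proof.
move=> symF I; have : perm_eq (val (sort_stuple I)) I by rewrite /= perm_sort.
by case/tuple_permP => p def_sort; rewrite (symF p); congr F; apply: val_inj.
Qed.

Theorem proposition3p3 (R : realType) (n k l : nat)
    (hn : (1 <= n)%N) (hl : (l <= 1)%N)
    (f : 'Hom(tpow R n k, tpow R n l))
    (f_equivariant : forall (s : 'S_n) (I : k.-tuple 'I_n),
      f (etensor R (perm_tuple s I)) = tpow_rep R l s (f (etensor R I)))
    (f_symmetric : forall (p : 'S_k) (I : k.-tuple 'I_n),
      f (etensor R I) = f (etensor R [tuple tnth I (p j) | j < k])) :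
  let fbar : 'Hom(spow R n k, spow R n l) :=
    lin_ext (fun J : stuple n k => tpow_to_spow R n l (f (etensor R (val J)))) in
  fbar \in HomSn R n k l /\
  (forall I : k.-tuple 'I_n,
     tpow_to_spow R n l (f (etensor R I)) = fbar (ebasis R (sort_stuple I))).
Proof.
move=> fbar.
have fbarE I : tpow_to_spow R n l (f (etensor R I)) = fbar (ebasis R (sort_stuple I)).
  rewrite lin_ext_basis; congr (tpow_to_spow _ _ _ _).
  exact: (sym_sort _ _ _ (fun I => f (etensor R I)) f_symmetric).
split=> //; apply/HomSnP => s v.
suff /lfunP/(_ v) : (fbar \o spow_rep R k s)%VF = (spow_rep R l s \o fbar)%VF.
  by rewrite !comp_lfunE.
apply: lfun_eq_basis => J; rewrite !comp_lfunE [spow_rep R k s _]lin_ext_basis.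
rewrite [fbar (std_basis R J)]lin_ext_basis.
(* [act_stuple s J] unfolds to [sort_stuple (perm_tuple s (val J))], so [fbarE] read backwards
   removes the sorting. The bound [l <= 1] lets the action pass through [tpow_to_spow]. *)
by rewrite -fbarE f_equivariant tpow_to_spow_equiv.
Qed.
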